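(* Let $A\in \mathbb{R}^{n\times n}$ have all entries integer and let $p\in[n]$. Then the sequence of matrices $\{D_p^k\}_{k\geq 1}$ associated with $A$ and $p$ stabilizes after a finite number of steps (i.e. there is $K$ such that $D_p^k=D_p^K$ for all $k\ge K$).
   Context: Notation: $[n]=\{1,\dots,n\}$. For $D\in(\mathbb{R}\cup\{-\infty\})^{n\times n}$, real row vectors $a,b$ of length $n$ and $p\in[n]$, put $$\mathtt{MinMaxValue}(D,a,b\mid p,n+1-p)=\min_{S_1,S_2}\ \max_{i\in S_1,\,j\in S_2}\bigl(D(i,j)+a_i-b_j\bigr),$$ where $S_1$ ranges over all $p$-element subsets and $S_2$ over all $(n+1-p)$-element subsets of $[n]$. The sequence $\{D_p^k\}_{k\ge0}$ is defined by $D_p^0=I_n$ (the max-plus identity: zero diagonal, $-\infty$ off the diagonal) and $D_p^{k+1}(i,j)=\mathtt{MinMaxValue}(D_p^k,A_i,A_j\mid p,n+1-p)$ for all $i,j\in[n]$, where $A_i$ denotes the $i$-th row of $A$. *)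

(* Defs.v *)
From mathcomp Require Import all_boot all_order all_algebra.
From mathcomp Require Import reals constructive_ereal.

Set Implicit Arguments.
Unset Strict Implicit.
Unset Printing Implicit Defensive.

Import Order.TTheory GRing.Theory Num.Theory.

Local Open Scope ring_scope.
Local Open Scope ereal_scope.

(* The max-plus numbers, reals with -oo, are represented in [\bar R]; [+oo] serves
   only as the neutral element of the minimum.  For 1 <= p, q <= n all the
   families below are nonempty, so the bounds [+oo] and [-oo] are never the
   value of an empty minimum or maximum. *)
Definition MinMaxValue (R : realType) (n : nat) (D : 'M[\bar R]_n)
    (a b : 'rV[R]_n) (p q : nat) : \bar R :=
  \big[mine/+oo]_(S1 : {set 'I_n} | #|S1| == p)
    \big[mine/+oo]_(S2 : {set 'I_n} | #|S2| == q)
      \big[maxe/-oo]_(i in S1) \big[maxe/-oo]_(j in S2)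
        (D i j + (a ord0 i)%:E - (b ord0 j)%:E).

Definition maxplus_id (R : realType) (n : nat) : 'M[\bar R]_n :=
  \matrix_(i, j) (if i == j then 0 else -oo).

Fixpoint D_seq (R : realType) (n : nat) (A : 'M[R]_n) (p k : nat) :
    'M[\bar R]_n :=
  match k with
  | 0 => maxplus_id R n
  | k'.+1 => \matrix_(i, j)
      MinMaxValue (D_seq A p k') (row i A) (row j A) p (n.+1 - p)
  end.

(* Main.v *)
Require Import Defs.
From mathcomp Require Import all_boot all_order all_algebra.
From mathcomp Require Import boolp reals constructive_ereal.

(** The potential matrices x_i - x_j are preserved by the iteration: they are
    sent to y_i - y_j, where y_i is the p-th smallest of the numbers
    x_s + A(i,s), and y_i - y_j is at most the largest of the A(i,s) - A(j,s).
    Since the max-plus identity lies below the zero potential and the iteration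
    is monotone, this bounds every D_p^k uniformly in k.  As D_p^0 <= D_p^1, the
    sequence is nondecreasing; from k = 1 on its entries are integers, and a
    bounded nondecreasing sequence of integers is stationary. *)

Set Implicit Arguments.
Unset Strict Implicit.
Unset Printing Implicit Defensive.

Import Order.TTheory GRing.Theory Num.Theory.

Local Open Scope ring_scope.

Lemma nondecreasing_nat_stationary (w : nat -> nat) (b : nat) :
  {homo w : k l / (k <= l)%N} -> (forall k, (w k <= b)%N) ->
  exists K, forall k, (K <= k)%N -> w k = w K.
Proof.
(* Induction on the slack [d] left between [w K] and [b]: either [w] exceeds [w K] at some later
   index, which uses up one unit of slack, or it is constant from [K] on. *)
move=> w_homo w_le; suff: forall d K, (b <= w K + d)%N ->
    exists K, forall k, (K <= k)%N -> w k = w K.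
  by move=> /(_ b 0%N); apply; rewrite leq_addl.
elim=> [|d IHd] K b_le.
  exists K => k Kk; apply/eqP; rewrite eqn_leq (w_homo _ _ Kk) andbT.
  by rewrite (leq_trans (w_le k)) // -[w K]addn0.
have [[l [Kl wl]]|w_const] := EM (exists l, (K <= l)%N /\ (w K < w l)%N).
  by apply: (IHd l); rewrite (leq_trans b_le) // addnS -addSn leq_add2r.
exists K => k Kk; apply/eqP; rewrite eqn_leq (w_homo _ _ Kk) andbT leqNgt.
by apply/negP => wk; apply: w_const; exists k.
Qed.

(** Infinite values pass by convention, so the predicate covers the [-oo] entries of the max-plus
    identity and the neutral elements of the minima and maxima. *)
Definition int_ereal (R : realType) (x : \bar R) : bool :=
  (x \is a fin_num) ==> (fine x \is a Num.int).

Lemma nondecreasing_int_ereal_stationary (R : realType) (u : nat -> \bar R)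
    (b : R) :
  (forall k, (u k <= u k.+1)%E) -> (forall k, (u k <= b%:E)%E) ->
  (forall k, int_ereal (u k)) -> (-oo < u 0%N)%E ->
  exists K, forall k, (K <= k)%N -> u k = u K.
Proof.
move=> u_incr u_le u_int u0_gt.
have u_homo : {homo u : k l / (k <= l)%N >-> (k <= l)%E}.
  by apply: homo_leq => // x y z; apply: le_trans.
have u_fin k : u k \is a fin_num.
  rewrite fin_real // (lt_le_trans u0_gt (u_homo _ _ (leq0n k))) /=.
  exact: le_lt_trans (u_le k) (ltry b).
have d_ge0 k : 0 <= fine (u k) - fine (u 0%N).
  by rewrite subr_ge0 fine_le // u_homo.
(* The differences from the initial term are nonnegative integers, so truncation loses nothing and
   the natural-number case applies. *)
pose w k := Num.trunc (fine (u k) - fine (u 0%N)).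
have wE k : (w k)%:R = fine (u k) - fine (u 0%N).
  apply: truncK; rewrite natrEint d_ge0 andbT rpredB //.
    exact: implyP (u_int k) (u_fin k).
  exact: implyP (u_int 0%N) (u_fin 0%N).
have [|k|K w_const] := @nondecreasing_nat_stationary w
    (Num.bound (b - fine (u 0%N))).
- move=> k l kl; rewrite -(ler_nat R) !wE lerD2r fine_le //.
  exact: u_homo.
- have le_b : fine (u k) - fine (u 0%N) <= b - fine (u 0%N).
    by rewrite lerD2r -lee_fin fineK.
  rewrite -(ler_nat R) wE (le_trans le_b) // ltW // archi_boundP //.
  exact: le_trans (d_ge0 k) le_b.
exists K => k Kk; rewrite -[u k]fineK // -[u K]fineK //; congr (_%:E).
by apply: (addIr (- fine (u 0%N))); rewrite -!wE w_const.
Qed.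

(** Pigeonhole: the two sizes add up to [n.+1], one more than the union can hold. *)
Lemma card_meet (n p : nat) (S1 S2 : {set 'I_n}) :
  (0 < p <= n)%N -> #|S1| = p -> #|S2| = (n.+1 - p)%N ->
  exists s, (s \in S1) && (s \in S2).
Proof.
move=> /andP[p_gt0 p_le] S1p S2q.
have /card_gt0P[s] : (0 < #|S1 :&: S2|)%N.
  have := cardsUI S1 S2; rewrite S1p S2q subnKC ?leqW // => cardE.
  have := max_card (mem (S1 :|: S2)); rewrite card_ord => U_le.
  by rewrite -(ltn_add2l #|S1 :|: S2|) addn0 cardE ltnS.
by rewrite inE; exists s.
Qed.

Lemma order_statistic (R : realType) (n p : nat) (x : 'I_n -> R) :
  (0 < p <= n)%N ->
  exists m : R, exists S1 : {set 'I_n}, exists S2 : {set 'I_n},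
    [/\ #|S1| = p, #|S2| = (n.+1 - p)%N,
        forall s, s \in S1 -> x s <= m & forall t, t \in S2 -> m <= x t].
Proof.
move=> /andP[p_gt0 p_le]; have n_gt0 := leq_trans p_gt0 p_le.
pose leT : rel 'I_n := fun s t => x s <= x t.
pose o := sort leT (enum 'I_n); pose i0 := Ordinal n_gt0.
have leT_trans : transitive leT by move=> t s r; apply: le_trans.
have leT_refl : reflexive leT by move=> s; apply: lexx.
have o_sorted : sorted leT o by apply: sort_sorted => s t; apply: le_total.
have o_uniq : uniq o by rewrite sort_uniq enum_uniq.
have o_size : size o = n by rewrite size_sort size_enum_ord.
have o_le := sorted_leq_nth leT_trans leT_refl i0 o_sorted.
have p1_lt : (p.-1 < n)%N by rewrite prednK.
(* The p-th smallest value sits at position [p.-1], counted from 0; that position belongs to both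
   the initial and the final segment, hence the sizes [p] and [n.+1 - p]. *)
exists (x (nth i0 o p.-1)), [set s in take p o], [set t in drop p.-1 o].
split.
- rewrite cardsE (card_uniqP (take_uniq _ o_uniq)) size_take o_size.
  by case: ltngtP p_le.
- rewrite cardsE (card_uniqP (drop_uniq _ o_uniq)) size_drop o_size.
  by rewrite -[in RHS](prednK p_gt0) subSS.
- move=> s; rewrite inE => /(nthP i0)[k]; rewrite size_takel ?o_size // => kp.
  rewrite nth_take // => <-; apply: o_le; rewrite ?inE ?o_size //.
    exact: leq_trans kp p_le.
  by rewrite -ltnS prednK.
- move=> t; rewrite inE => /(nthP i0)[k]; rewrite size_drop o_size ltn_subRL.
  by move=> kn; rewrite nth_drop => <-; apply: o_le; rewrite ?inE ?o_size ?leq_addr.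
Qed.

Section MinMaxValueTheory.
Variables (R : realType) (n : nat).
Implicit Types (D : 'M[\bar R]_n) (a b : 'rV[R]_n) (p q : nat).

Lemma MinMaxValue_le_max D a b p q (S1 S2 : {set 'I_n}) (m : \bar R) :
  #|S1| = p -> #|S2| = q ->
  (forall i j, i \in S1 -> j \in S2 ->
    (D i j + (a ord0 i)%:E - (b ord0 j)%:E <= m)%E) ->
  (MinMaxValue D a b p q <= m)%E.
Proof.
move=> S1p S2q D_le; apply: (bigmin_inf S1); first exact/eqP.
apply: (bigmin_inf S2); first exact/eqP.
apply: bigmax_le => [|i S1i]; first exact: leNye.
by apply: bigmax_le => [|j S2j]; [exact: leNye | exact: D_le].
Qed.

(** Any admissible [S1] and [S2] share an index, so each inner maximum includes a diagonal term. *)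
Lemma MinMaxValue_diag_ge D a b p (m : \bar R) :
  (0 < p <= n)%N ->
  (forall s, (m <= D s s + (a ord0 s)%:E - (b ord0 s)%:E)%E) ->
  (m <= MinMaxValue D a b p (n.+1 - p))%E.
Proof.
move=> p_range D_ge; apply: le_bigmin => [|S1 /eqP S1p]; first exact: leey.
apply: le_bigmin => [|S2 /eqP S2q]; first exact: leey.
have [s /andP[S1s S2s]] := card_meet p_range S1p S2q.
by apply: (bigmax_sup s) => //; apply: (bigmax_sup s).
Qed.

Lemma le_MinMaxValue D D' a b p q :
  (forall i j, (D i j <= D' i j)%E) ->
  (MinMaxValue D a b p q <= MinMaxValue D' a b p q)%E.
Proof.
move=> D_le; apply: le_bigmin2 => S1 _; apply: le_bigmin2 => S2 _.
apply: le_bigmax2 => i _; apply: le_bigmax2 => j _.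
by rewrite !leeD2r.
Qed.

Lemma MinMaxValue_int D a b p q :
  (forall i j, int_ereal (D i j)) ->
  (forall s, a ord0 s \is a Num.int) -> (forall s, b ord0 s \is a Num.int) ->
  int_ereal (MinMaxValue D a b p q).
Proof.
move=> D_int a_int b_int.
have min_int (x y : \bar R) : int_ereal x -> int_ereal y -> int_ereal (mine x y).
  by rewrite /Order.min; case: ifP.
have max_int (x y : \bar R) : int_ereal x -> int_ereal y -> int_ereal (maxe x y).
  by rewrite /Order.max; case: ifP.
apply: (big_ind (@int_ereal R)) => // S1 _; apply: (big_ind (@int_ereal R)) => // S2 _.
apply: (big_ind (@int_ereal R)) => // i _; apply: (big_ind (@int_ereal R)) => // j _.
move: (D_int i j); case: (D i j) => [r| |] // r_int.
by rewrite /int_ereal /= rpredB // rpredD.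
Qed.

End MinMaxValueTheory.

Section Iterates.
Variables (R : realType) (n : nat) (A : 'M[R]_n) (p : nat).
Hypothesis p_range : (0 < p <= n)%N.

Let D := D_seq A p.

Lemma D_seq_incr k (i j : 'I_n) : (D k i j <= D k.+1 i j)%E.
Proof.
elim: k i j => [|k IHk] i j; rewrite [X in (_ <= X)%E]mxE; last first.
  by rewrite mxE; apply: le_MinMaxValue.
(* On the diagonal both rows coincide, so every diagonal term of the first iterate is 0. *)
rewrite mxE; case: eqP => [<-|_]; last exact: leNye.
apply: MinMaxValue_diag_ge => // s.
by rewrite !mxE eqxx add0e -EFinB subrr.
Qed.

Lemma D_seq1_gt (i j : 'I_n) : (-oo < D 1 i j)%E.
Proof.
(* The diagonal terms are the finite numbers [A i s - A j s]; the default 0 can only lower this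
   bound. *)
apply: (lt_le_trans (ltNyr (\big[Num.min/0]_s (A i s - A j s)))).
rewrite mxE; apply: MinMaxValue_diag_ge => // s.
by rewrite !mxE eqxx add0e -EFinB lee_fin bigmin_le.
Qed.

(* A potential x dominating D_k gives the potential dominating D_{k+1} whose
   i-th coordinate is the p-th smallest of the x_s + A(i,s). *)
Lemma D_seq_le_potential k :
  exists2 x : 'I_n -> R, forall i j, (D k i j <= (x i - x j)%:E)%E &
    (0 < k)%N -> forall i j, exists s, x i - x j <= A i s - A j s.
Proof.
elim: k => [|k [x D_le _]].
  exists (fun=> 0) => // i j; rewrite mxE subrr.
  by case: eqP => // _; exact: leNye.
have [y /fin_all_exists[S1 /fin_all_exists[S2 yP]]] :=
  fin_all_exists (fun i => order_statistic (fun s => x s + A i s) p_range).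
exists y => [i j|_ i j].
  (* The minimum is tested on the lower set of [i] and the upper set of [j]. *)
  have [S1p _ y_ge _] := yP i; have [_ S2q _ y_le] := yP j.
  rewrite mxE; apply: (MinMaxValue_le_max S1p S2q) => s t S1s S2t.
  have /le_trans -> // := leeD2r (- (row j A ord0 t)%:E)
    (leeD2r (row i A ord0 s)%:E (D_le s t)).
  rewrite !mxE -!EFinD lee_fin.
  have := lerB (y_ge s S1s) (y_le t S2t); congr (_ <= _).
  by rewrite opprD addrACA addrA.
(* With the roles swapped, the upper set of [i] meets the lower set of [j] at some [s], where [x s]
   cancels: the bound on [y i - y j] no longer depends on the previous potential. *)
have [_ S2q _ y_le] := yP i; have [S1p _ y_ge _] := yP j.
have [s /andP[S1s S2s]] := card_meet p_range S1p S2q.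
exists s; have := lerB (y_le s S2s) (y_ge s S1s).
by rewrite opprD addrACA subrr add0r.
Qed.

Lemma D_seq_bounded (i j : 'I_n) :
  exists b : R, forall k, (D k.+1 i j <= b%:E)%E.
Proof.
exists (\big[Num.max/0]_s (A i s - A j s)) => k.
have [x /(_ i j) D_le /(_ isT i j)[s xs]] := D_seq_le_potential k.+1.
apply: (le_trans D_le); rewrite lee_fin (le_trans xs) //.
exact: le_bigmax.
Qed.

Lemma D_seq_int k (i j : 'I_n) :
  (forall i j, A i j \is a Num.int) -> int_ereal (D k i j).
Proof.
move=> A_int; elim: k i j => [|k IHk] i j; rewrite mxE.
  by case: eqP => _ //; rewrite /int_ereal rpred0 implybT.
by apply: MinMaxValue_int => // s; rewrite mxE.
Qed.

End Iterates.

Theorem proposition3p7 (R : realType) (n : nat) (A : 'M[R]_n) (p : nat)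
    (A_int : forall i j : 'I_n, A i j \is a Num.int)
    (p_range : (1 <= p <= n)%N) :
  exists K : nat, (1 <= K)%N /\
    forall k : nat, (K <= k)%N -> D_seq A p k = D_seq A p K.
Proof.
have entry_stationary (ij : 'I_n * 'I_n) : exists K, forall k, (K <= k)%N ->
    D_seq A p k.+1 ij.1 ij.2 = D_seq A p K.+1 ij.1 ij.2.
  have [b D_le] := D_seq_bounded A p_range ij.1 ij.2.
  apply: (@nondecreasing_int_ereal_stationary R
            (fun k => D_seq A p k.+1 ij.1 ij.2) b) => // [k|k|].
  - exact: D_seq_incr.
  - exact: D_seq_int.
  - exact: D_seq1_gt.
have [K KP] := fin_all_exists entry_stationary.
(* One threshold serves the finitely many entries; the successor undoes the shift that skipped
   [D_p^0], whose off-diagonal entries are [-oo]. *)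
exists (\max_ij K ij).+1; split=> // -[//|k]; rewrite ltnS => K_le.
apply/matrixP => i j; have K_max := leq_bigmax (F := K) (i, j).
by rewrite (KP (i, j)) 1?(leq_trans K_max) // -(KP (i, j) _ K_max).
Qed.
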